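(* Adaptation is necessary for achieving the capacity region of the Gaussian 3-way channel within a constant gap. Precisely, let $\mathcal{C}^{\mathrm{na}}(\Gamma_1,\Gamma_2,\Gamma_3)$ denote the set of rate tuples achievable in the 3WC$(\Gamma_1,\Gamma_2,\Gamma_3)$ channel when user 1 is not allowed to adapt, i.e. its encoder is restricted to the form $x_1(t)=\mathcal{E}_{1t}(w_{21},w_{31})$. Then there is no constant $c\ge0$, independent of $(\Gamma_1,\Gamma_2,\Gamma_3)$, such that for all $\Gamma_3\ge\Gamma_2\ge\Gamma_1$ and all $(R_{ij})\in\mathcal{C}(\Gamma_1,\Gamma_2,\Gamma_3)$ the tuple $(\max\{0,R_{ij}-c\})$ belongs to $\mathcal{C}^{\mathrm{na}}(\Gamma_1,\Gamma_2,\Gamma_3)$.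
   Context: Gaussian 3-way channel (3WC). Three full-duplex users $1,2,3$; at time $t$, for distinct $i,j,k\in\{1,2,3\}$, user $i$ receives $y_i(t)=h_jx_k(t)+h_kx_j(t)+z_i(t)$, where $x_i(t)\in\mathbb{R}$ is the transmit signal of user $i$, $h_i\in\mathbb{R}$ is the constant, reciprocal channel coefficient between users $j$ and $k$ (known to all users), and the noises $z_i(t)\sim\mathcal{N}(0,1)$ are independent across users and i.i.d. over time. Every user has (average) power constraint $P$: $\frac1n\sum_{t=1}^n\mathbb{E}[x_i(t)^2]\le P$. SNRs: $\Gamma_i=h_i^2P$. The users are labeled so that $h_3^2\ge h_2^2\ge h_1^2$. User $i$ has independent messages $w_{ji}$ and $w_{ki}$, uniformly distributed over sets $\mathcal{W}_{ji},\mathcal{W}_{ki}$, of rates $R_{ji}$ and $R_{ki}$, intended for users $j$ and $k$ respectively (so $w_{ab}$ goes from user $b$ to user $a$). All six messages are independent. Encoding may in general be adaptive: $x_i(t)=\mathcal{E}_{it}(w_{ji},w_{ki},y_i(1),\dots,y_i(t-1))$. After $n$ channel uses user $i$ decodes $(\hat w_{ij},\hat w_{ik})=\mathcal{D}_i(w_{ji},w_{ki},y_i(1),\dots,y_i(n))$. A rate tuple is achievable if the probability that some message is decoded incorrectly can be made to tend to $0$ as $n\to\infty$. The capacity region $\mathcal{C}(\Gamma_1,\Gamma_2,\Gamma_3)\subset\mathbb{R}_+^6$ is the set of all achievable tuples $(R_{21},R_{31},R_{12},R_{32},R_{13},R_{23})$. *)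

(* Defs.v *)
From HB Require Import structures.
From mathcomp Require Export all_boot all_order all_algebra.
From mathcomp Require Export all_classical all_reals all_analysis.
Export Order.TTheory GRing.Theory Num.Theory numFieldNormedType.Exports.

Set Implicit Arguments.
Unset Strict Implicit.
Unset Printing Implicit Defensive.

Local Open Scope classical_set_scope.
Local Open Scope ring_scope.

(* The law of n independent variables of law mu: the n-fold product measure
   on n-tuples (see iid_law_box). *)
Section iid_law.
Context d (T : measurableType d) (R : realType) (mu : probability T R).

Let consp n (p : T * n.-tuple T) : n.+1.-tuple T := [tuple of p.1 :: p.2].

Let measurable_consp n : measurable_fun [set: T * n.-tuple T] (@consp n).
Proof. exact: measurable_cons. Qed.

HB.instance Definition _ n :=
  isMeasurableFun.Build _ _ _ _ (@consp n) (@measurable_consp n).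

Fixpoint iid_law (n : nat) : probability (n.-tuple T) R :=
  if n is n'.+1 then distribution (mu \x iid_law n')%E (@consp n')
  else dirac [tuple].

Lemma iid_law_box n (A : 'I_n -> set T) : (forall i, measurable (A i)) ->
  iid_law n [set x | forall i, A i (tnth x i)] = (\prod_(i < n) mu (A i))%E.
Proof.
elim: n A => [|n IHn] A mA.
  by rewrite big_ord0 /= diracE mem_set // => -[].
rewrite big_ord_recl -IHn; last by move=> i; exact: mA.
rewrite /= /distribution /pushforward.
set B := [set x : n.-tuple T | forall i, A (lift ord0 i) (tnth x i)].
have mB : measurable B.
  rewrite (_ : B = \bigcap_(i in [set: 'I_n])
      ((fun x : n.-tuple T => tnth x i) @^-1` A (lift ord0 i))).
    apply: fin_bigcap_measurable => // i _.
    rewrite -[X in measurable X]setTI; exact: measurable_tnth.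
  by apply/seteqP; split=> [x Bx i _|x Bx i]; [exact: Bx|exact: (Bx i)].
rewrite -product_measure1E //; congr (_ _).
apply/seteqP; split=> -[a x] /=.
- move=> H; split=> [|i] /=; first by have := H ord0; rewrite tnth0.
  by have := H (lift ord0 i); rewrite tnthS.
- case=> /= Aa Bx i; case: (unliftP ord0 i) => [j ->|->].
    by rewrite tnthS; exact: Bx.
  by rewrite tnth0.
Qed.

End iid_law.

(* N(0, 1), carried from the type [measurableTypeR R] on which the library
   defines it to R with its own (equal) Borel sigma-algebra. *)
Section standard_normal.
Variable R : realType.

Let idTR : measurableTypeR R -> R := idfun.

HB.instance Definition _ :=
  @isMeasurableFun.Build _ _ _ _ idTR (@measurable_id _ _ setT).

Definition standard_normal : probability R R :=
  distribution (normal_prob 0 1) idTR.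

Lemma standard_normalE (A : set R) : standard_normal A = normal_prob 0 1 A.
Proof. by []. Qed.

End standard_normal.

(* Users 1, 2, 3 are the elements 0, 1, 2 of 'I_3.  As 'I_3 carries addition
   modulo 3, the two users other than i are i + 1 and i + 2. *)
Notation user := 'I_3.

Section channel.
Variable R : realType.

(* A rate tuple (R_21, R_31, R_12, R_32, R_13, R_23) is a nonnegative
   array r with zero diagonal; r a b is the rate from user b to user a. *)
Definition is_rate_tuple (r : user -> user -> R) : Prop :=
  (forall a b, 0 <= r a b) /\ (forall a, r a a = 0).

(* The number ceil (2 ^ (n r)) of messages of rate r (in bits) over n channel
   uses; it is 1 when r = 0, so that the diagonal carries no message. *)
Definition nmsg (n : nat) (r : R) : nat := `|Num.ceil (2 `^ (n%:R * r))|%N.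

Section code.
Variables (n : nat) (r : user -> user -> R).

Definition msg (a b : user) : finType := 'I_(nmsg n (r a b)).

(* w (a, b) is the message w_ab from user b to user a. *)
Definition messages : finType :=
  {dffun forall p : user * user, msg p.1 p.2}.

Definition sent_by (i : user) (w : messages) : forall a, msg a i :=
  fun a => w (a, i).

Definition sent_to (i : user) (w : messages) : forall b, msg i b :=
  fun b => w (i, b).

(* Time starts at 0: at time t, [enc i t] sees the t outputs received so far.
   Only the values of enc at times t < n are ever used. *)
Record code := Code {
  enc : forall (i : user) (t : nat), (forall a, msg a i) -> t.-tuple R -> R;
  dec : forall i : user, (forall a, msg a i) -> n.-tuple R ->
    forall b, msg i b;
  measurable_enc : forall i t v, measurable_fun setT (@enc i t v);
  measurable_dec : forall i v b (m : msg i b),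
    measurable [set y | @dec i v y b = m] }.

Definition nonadaptive (i : user) (c : code) : Prop :=
  exists f : nat -> (forall a, msg a i) -> R,
    forall t v (y : t.-tuple R), enc c v y = f t v.

Definition noise_law : probability (n.-tuple (3.-tuple R)) R :=
  iid_law (iid_law (@standard_normal R) 3) n.

(* z_i(t); the default value is never used, as t < n below *)
Definition noise (z : n.-tuple (3.-tuple R)) (t : nat) (i : user) : R :=
  tnth (nth [tuple of nseq 3 0] z t) i.

(* h i is the coefficient of the link between the two users other than i *)
Variables (h : user -> R) (c : code) (w : messages) 
  (z : n.-tuple (3.-tuple R)).

(* the outputs y_i(0), ..., y_i(t - 1) *)
Fixpoint received (t : nat) : forall i : user, t.-tuple R :=
  if t is s.+1 then fun i =>
    let x j := enc c (sent_by j w) (received s j) in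
    [tuple of rcons (received s i)
       (h (i + 1) * x (i + 2) + h (i + 2) * x (i + 1) + noise z s i)]
  else fun=> [tuple].

Definition transmitted (t : nat) (i : user) : R :=
  enc c (sent_by i w) (received t i).

Definition decoding_error : Prop :=
  exists i b, dec c (sent_by i w) (received n i) b <> sent_to i w b.

End code.

(* mean over independent, uniformly distributed messages *)
Definition message_mean n r (F : messages n r -> \bar R) : \bar R :=
  ((#|messages n r|%:R^-1)%:E * \sum_(w : messages n r) F w)%E.

Definition error_probability n r h (c : code n r) : \bar R :=
  message_mean (fun w => noise_law n [set z | decoding_error h c w z]).

Definition mean_power n r h (c : code n r) (i : user) (t : nat) : \bar R :=
  message_mean (fun w =>
    \int[noise_law n]_z ((transmitted h c w z t i) ^+ 2)%:E)%E.

Definition power_constraint n r h (P : R) (c : code n r) : Prop :=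
  forall i, ((n%:R^-1)%:E * \sum_(t < n) mean_power h c i t <= P%:E)%E.

Definition achievable_with (ok : forall n r, code n r -> Prop)
    (h : user -> R) (P : R) (r : user -> user -> R) : Prop :=
  exists c : forall n, code n r,
    [/\ forall n, ok n r (c n),
        forall n, power_constraint h P (c n) &
        error_probability h (c n) @[n --> \oo] --> 0%E].

Definition capacity_region (h : user -> R) (P : R) :
    set (user -> user -> R) :=
  [set r | is_rate_tuple r /\ achievable_with (fun _ _ _ => True) h P r].

(* only user 1, i.e. 0 : 'I_3, is not allowed to adapt *)
Definition capacity_region_na (h : user -> R) (P : R) :
    set (user -> user -> R) :=
  [set r | is_rate_tuple r /\
           achievable_with (fun n r => @nonadaptive n r 0) h P r].

Definition SNR (h : user -> R) (P : R) (i : user) : R := (h i) ^+ 2 * P.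

End channel.

(* Main.v *)
Require Import Defs.
From mathcomp Require Import measurable_realfun zify lra ring.

(* Take h_1 = 0, so that users 2 and 3 only communicate through user 1.  If user
   1 does not adapt, the output of user 3 is independent of the message w_32,
   so every achievable tuple has R_32 = 0.  If user 1 adapts, every value of
   R_32 is achievable for large P: user 2 sends the symbols of a codeword over
   a large alphabet as equally spaced amplitudes, and user 1 quantises each
   output and forwards the symbol at the next time.  Once the spacing dominates
   the noise, symbol errors are so rare that, by a union bound over the set of
   noisy times, they are corrected by a code of linear minimum distance, which
   exists by the Gilbert-Varshamov argument. *)

Set Implicit Arguments.
Unset Strict Implicit.
Unset Printing Implicit Defensive.

Local Open Scope classical_set_scope.
Local Open Scope ring_scope.

(** * Codes of large minimum distance *)

Section codes.
Local Open Scope nat_scope.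

Lemma leq_card_bigcup (I : Type) (r : seq I) (P : pred I) (T : finType)
    (F : I -> {set T}) :
  #|\bigcup_(i <- r | P i) F i|%SET <= \sum_(i <- r | P i) #|F i|.
Proof.
elim/big_rec2: _ => [|i m A _ Am]; first by rewrite cards0.
by apply: leq_trans (leq_card_setU _ _) _; rewrite leq_add2l.
Qed.

Section Hamming.
Variables T q : finType.
Implicit Types u v w c : {ffun T -> q}.

Definition diff_set u v : {set T} := [set t | u t != v t]%SET.

Lemma diff_set_sym u v : diff_set u v = diff_set v u.
Proof. by apply/setP => t; rewrite !inE eq_sym. Qed.

Lemma card_diff_set_triangle v u w :
  #|diff_set u w| <= #|diff_set u v| + #|diff_set v w|.
Proof.
apply: leq_trans (leq_card_setU _ _); apply: subset_leq_card.
apply/fintype.subsetP => t; rewrite !inE; apply: contraR.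
by rewrite negb_or !negbK => /andP[/eqP -> /eqP ->].
Qed.

(** Words are sorted by the set [S] of positions where they differ from [c]: there are at most
    [2 ^ #|T|] such sets, and each leaves at most [#|q| ^ #|S|] words. This crude count of sets
    costs little over a large alphabet. *)
Lemma card_Hamming_ball (D : nat) c : 0 < #|q| ->
  #|[set u | #|diff_set c u| <= D]%SET| <= 2 ^ #|T| * #|q| ^ D.
Proof.
move=> q0.
pose F (S : {set T}) := [set u : {ffun T -> q} | diff_set c u == S]%SET.
have sub : ([set u | #|diff_set c u| <= D]%SET \subset
    \bigcup_(S : {set T} | #|S| <= D) F S)%SET.
  apply/fintype.subsetP => u; rewrite inE => uD.
  by apply/finset.bigcupP; exists (diff_set c u); rewrite ?inE.
apply: leq_trans (subset_leq_card sub) _.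
apply: leq_trans (leq_card_bigcup _ _ _) _ => //.
apply: (@leq_trans (\sum_(S : {set T} | #|S| <= D) #|q| ^ D)); last first.
  rewrite sum_nat_const leq_mul2r; apply/orP; right.
  rewrite -[X in _ <= 2 ^ X]cardsT -card_powerset; apply: subset_leq_card.
  by apply/fintype.subsetP => S _; rewrite powersetE finset.subsetT.
apply: leq_sum => S SD.
apply: (@leq_trans (#|q| ^ #|S|)); last by rewrite leq_pexp2l.
(* Values allowed at [t]: anything on [S], only [c t] elsewhere. *)
pose G (t : T) : pred q := if t \in S then predT else pred1 (c t).
apply: (@leq_trans #|family G|).
  apply: subset_leq_card; apply/fintype.subsetP => u; rewrite inE => /eqP cuS.
  apply/familyP => t; rewrite /G -cuS inE.
  by case: eqVneq => [->|_] //; rewrite inE.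
rewrite card_family foldrE big_image /= -prod_nat_const [leqRHS]big_mkcond /=.
apply: leq_prod => t _; rewrite /G; case: ifP => // _.
by rewrite card1.
Qed.

(* The balls of radius D around the words of a maximal code cover the space. *)
Lemma Gilbert_Varshamov (D M : nat) : 0 < #|q| ->
  M * (2 ^ #|T| * #|q| ^ D) <= #|q| ^ #|T| ->
  exists C : {set {ffun T -> q}},
    M <= #|C| /\ {in C &, forall u v, u != v -> D < #|diff_set u v|}.
Proof.
move=> q0 le.
pose sep (C : {set {ffun T -> q}}) :=
  [forall u in C, forall v in C, (u != v) ==> (D < #|diff_set u v|)].
have sep0 : exists C, sep C.
  by exists finset.set0; apply/'forall_implyP => u; rewrite inE.
have [C /finset.maxsetP[sepC maxC]] := finset.ex_maxset sep0.
have sepP u v : u \in C -> v \in C -> u != v -> D < #|diff_set u v|.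
  move: sepC => /'forall_implyP/(_ u)/[apply]/'forall_implyP/(_ v)/[apply].
  by move=> /implyP.
exists C; split; last by move=> u v uC vC; exact: sepP.
have cover : ([set: {ffun T -> q}] \subset
    \bigcup_(c in C) [set u | #|diff_set c u| <= D])%SET.
  apply/fintype.subsetP => u _; apply/finset.bigcupP.
  have [uC|uC] := boolP (u \in C).
    exists u => //; rewrite inE.
    suff -> : diff_set u u = finset.set0 by rewrite cards0.
    by apply/setP => t; rewrite !inE eqxx.
  suff : ~~ [forall c in C, D < #|diff_set c u|].
    by move=> /forall_inPn[c cC]; rewrite -leqNgt => h; exists c; rewrite ?inE.
  apply: contra uC => /'forall_implyP far.
  (* If [u] is far from every codeword, [u |: C] is still separated, so maximality forces [u |: C]
     to equal [C]. *)
  rewrite -(maxC (u |: C)%SET) ?finset.subsetUr ?setU11 //.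
  apply/'forall_implyP => a /finset.setU1P aC.
  apply/'forall_implyP => b /finset.setU1P bC.
  apply/implyP => ab; case: aC bC => [au|aC] [bu|bC].
  - by move: ab; rewrite au bu eqxx.
  - by rewrite au diff_set_sym; exact: far.
  - by rewrite bu; exact: far.
  - exact: sepP.
(* The covering bounds [#|q| ^ #|T|] by [#|C|] times the size of a ball; comparison with [le] lets
   the ball factor cancel. *)
have := subset_leq_card cover; rewrite cardsT card_ffun => /(leq_trans le) le1.
rewrite -(@leq_pmul2r (2 ^ #|T| * #|q| ^ D)) ?muln_gt0 ?expn_gt0 ?q0 //.
apply: (leq_trans le1); apply: leq_trans (leq_card_bigcup _ _ _) _ => //.
by rewrite -sum_nat_const; apply: leq_sum => c _; exact: card_Hamming_ball.
Qed.

End Hamming.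

End codes.

(** * Measurability and the converse *)

Section message_number.
Variable R : realType.

Lemma ceil_powR2_gt0 (x : R) : 0 < Num.ceil (2 `^ x).
Proof.
have : 0 < (Num.ceil (2 `^ x))%:~R :> R.
  by apply: lt_le_trans (ceil_ge _); rewrite powR_gt0.
by rewrite ltr0z.
Qed.

Lemma nmsg_gt0 n (r : R) : (0 < nmsg n r)%N.
Proof. by have := ceil_powR2_gt0 (n%:R * r); rewrite /nmsg; lia. Qed.

Lemma nmsg0 n : nmsg n (0 : R) = 1%N.
Proof. by rewrite /nmsg mulr0 powRr0 ceil1. Qed.

Lemma nmsg_gt1 n (r : R) : (0 < n)%N -> 0 < r -> (1 < nmsg n r)%N.
Proof.
move=> n0 r0.
have : 1 < (Num.ceil (2 `^ (n%:R * r)))%:~R :> R.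
  apply: lt_le_trans (ceil_ge _).
  have nr0 : 0 < n%:R * r by rewrite mulr_gt0 // ltr0n.
  have := @gt0_ltr_powR R _ nr0 1 2; rewrite powR1; apply;
    rewrite ?nnegrE ?ltr1n //.
by rewrite ltr1z /nmsg; lia.
Qed.

Lemma nmsg_le n (r : R) (K : nat) : r <= K%:R -> (nmsg n r <= 2 ^ (n * K))%N.
Proof.
move=> rK.
have : Num.ceil (2 `^ (n%:R * r)) <= (2 ^ (n * K))%N :> int.
  rewrite ceil_le_int -pmulrn natrX -powR_mulrn // ler_powR ?ler1n //.
  by rewrite natrM ler_wpM2l.
have := ceil_powR2_gt0 (n%:R * r).
by rewrite /nmsg; lia.
Qed.

End message_number.

Section measurability.
Context (R : realType) (n : nat) (r : user -> user -> R) (h : user -> R)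
  (c : code n r).

Lemma measurable_noise t i :
  measurable_fun setT (fun z : n.-tuple (3.-tuple R) => noise z t i).
Proof.
have [tn|nt] := ltnP t n; last first.
  rewrite (_ : (fun _ => _) = cst 0) //; apply/funext => z /=.
  rewrite /noise nth_default ?size_tuple //.
  by rewrite (tnth_nth 0) nth_nseq ltn_ord.
rewrite (_ : (fun _ => _) =
    (fun u : 3.-tuple R => tnth u i) \o (fun z => tnth z (Ordinal tn))).
  by apply: measurableT_comp; exact: measurable_tnth.
by apply/funext => z /=; rewrite /noise (tnth_nth [tuple of nseq 3 0]).
Qed.

Lemma measurable_rcons d (T : measurableType d) m (f : T -> m.-tuple R)
    (g : T -> R) : measurable_fun setT f -> measurable_fun setT g ->
  measurable_fun setT (fun x => [tuple of rcons (f x) (g x)]).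
Proof.
move=> mf mg; apply/measurable_fun_tnthP => i.
have [im|mi] := ltnP i m.
  rewrite (_ : _ \o _ = (fun x => tnth (f x) (Ordinal im))).
    by apply: (measurableT_comp (measurable_tnth _)).
  apply/funext => x /=.
  by rewrite !(tnth_nth 0) /= nth_rcons size_tuple im.
rewrite (_ : _ \o _ = g) //; apply/funext => x /=.
rewrite (tnth_nth 0) /= nth_rcons size_tuple ltnNge mi /=.
by rewrite ifT // eqn_leq mi -ltnS ltn_ord.
Qed.

Lemma measurable_received (w : messages n r) t i :
  measurable_fun setT (fun z => received h c w z t i).
Proof.
elim: t i => [|t IH] i; first exact: measurable_cst.
have mx j : measurable_fun setT
    (fun z => enc c (sent_by j w) (received h c w z t j)).
  by apply: measurableT_comp => //; exact: measurable_enc.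
apply: measurable_rcons => //.
apply: measurable_funD; last exact: measurable_noise.
by apply: measurable_funD; apply: measurable_realfun.measurable_funM.
Qed.

Lemma measurable_transmitted (w : messages n r) t i :
  measurable_fun setT (fun z => transmitted h c w z t i).
Proof.
apply: measurableT_comp; [exact: measurable_enc|exact: measurable_received].
Qed.

Lemma measurable_decoding_error (w : messages n r) :
  measurable [set z | decoding_error h c w z].
Proof.
rewrite (_ : [set _ | _] = \bigcup_(p in [set: user * user])
   (fun z => received h c w z n p.1) @^-1`
   ~` [set y | dec c (sent_by p.1 w) y p.2 = sent_to p.1 w p.2]).
  apply: fin_bigcup_measurable => // -[i b] _ /=.
  rewrite -[X in measurable X]setTI; apply: measurable_received => //.
  by apply: measurableC; exact: measurable_dec.
apply/seteqP; split => z /=.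
  by move=> [i [b ib]]; exists (i, b).
by move=> [[i b] _ ib]; exists i, b.
Qed.

End measurability.

(** * Converse when the relaying user does not adapt *)

Section converse.
Variables (R : realType) (n : nat) (r : user -> user -> R) (h : user -> R)
  (c : code n r).
Hypotheses (h0 : h 0 = 0) (cna : nonadaptive 0 c).

(* When h 0 = 0, user 2 only hears user 0, whose signal is a function of its
   own messages. *)
Lemma received_na_indep (w w' : messages n r) z t :
  sent_by 0 w = sent_by 0 w' -> received h c w z t 2 = received h c w' z t 2.
Proof.
move=> ww; have [f fE] := cna.
elim: t => [//|t IH]; apply: val_inj => /=; congr rcons; first by rewrite IH.
have -> : (2 + 1 : user) = 0 by apply/val_inj.
have -> : (2 + 2 : user) = 1 by apply/val_inj.
by rewrite h0 !mul0r !fE ww.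
Qed.

Lemma dec_na_indep (w w' : messages n r) z b :
  sent_by 0 w = sent_by 0 w' -> sent_by 2 w = sent_by 2 w' ->
  dec c (sent_by 2 w) (received h c w z n 2) b =
  dec c (sent_by 2 w') (received h c w' z n 2) b.
Proof. by move=> w0 w2; rewrite (received_na_indep _ _ w0) w2. Qed.

(** Moves the message from user 1 to user 2 ([w_32] in the labels 1, 2, 3) to its cyclic successor.
    This permutes the message tuples and alters nothing that users 0 and 2 send. *)
Definition shift_21 (w : messages n r) : messages n r :=
  [ffun p => if p == (2, 1) then ordS (w p) else w p].

Lemma shift_21_inj : injective shift_21.
Proof.
move=> w w' /ffunP ww; apply/ffunP => p; have := ww p; rewrite !ffunE.
by case: ifP => // _ /ordS_inj.
Qed.

Lemma sent_by_shift_21 (w : messages n r) i :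
  i != 1 -> sent_by i (shift_21 w) = sent_by i w.
Proof.
move=> i1; apply/functional_extensionality_dep => a.
by rewrite /sent_by ffunE xpair_eqE (negbTE i1) andbF.
Qed.

(** User 2 produces the same estimate for [w] and for [shift_21 w], while the true messages differ,
    so at least one estimate is wrong. *)
Lemma decoding_error_shift_21 (w : messages n r) z :
  (1 < nmsg n (r 2%R 1%R))%N ->
  decoding_error h c w z \/ decoding_error h c (shift_21 w) z.
Proof.
move=> M1; have [|ok] := pselect (decoding_error h c w z); [by left|right].
exists 2, 1 => wrong; apply: ok; exists 2, 1 => right_.
move: wrong; rewrite (@dec_na_indep _ w) ?sent_by_shift_21 //.
rewrite right_ /sent_to ffunE eqxx => /(congr1 val) /=.
move: (w (2, 1)) M1; rewrite /= /msg; move: (nmsg _ _) => M x M1.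
(* The cyclic successor of [x] differs from [x], both without and with wrap-around, because [M]
   exceeds 1. *)
have [xM|Mx] := ltnP x.+1 M; first by rewrite modn_small //; lia.
have -> : x.+1 = M by apply/eqP; rewrite eqn_leq ltn_ord.
by rewrite modnn => x0; move: Mx M1; rewrite x0; lia.
Qed.

(** Reindexing by [shift_21] preserves the sum [S] of the error probabilities. In [S + S], the
    errors of [w] and of its shift pair up and cover the whole space, so each [w] contributes at
    least 1. *)
Lemma error_na_ge : (1 < nmsg n (r 2%R 1%R))%N ->
  (2^-1%:E <= error_probability h c)%E.
Proof.
move=> M1; rewrite /error_probability /message_mean.
pose E w := [set z | decoding_error h c w z].
pose S := (\sum_(w : messages n r) noise_law R n (E w))%E.
have W0 : (0 < #|messages n r|)%N.
  apply/card_gt0P.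
  by exists [ffun p : user * user => Ordinal (nmsg_gt0 n (r p.1 p.2))].
have SE : S = (\sum_(w : messages n r) noise_law R n (E (shift_21 w)))%E.
  by rewrite /S (reindex_inj shift_21_inj).
have S0 : (0 <= S)%E by apply: sume_ge0 => w _; exact: measure_ge0.
have : (#|messages n r|%:R%:E <= S + S)%E.
  rewrite {2}SE /S -big_split /=.
  have -> : #|messages n r|%:R%:E = (\sum_(w : messages n r) 1%:E)%E :> \bar R.
    by rewrite sumEFin sumr_const.
  apply: lee_sum => w _.
  have mE w' : measurable (E w') by exact: measurable_decoding_error.
  apply: le_trans (measureU2 _ (mE _) (mE _)).
  rewrite (_ : E w `|` _ = setT); last first.
    by apply/seteqP; split => // z _; exact: decoding_error_shift_21.
  rewrite le_eqVlt; apply/orP; left; apply/eqP; symmetry.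
  exact: (probability_setT (noise_law R n)).
change (\sum_w noise_law R n [set z | decoding_error h c w z])%E with S.
rewrite lee_pdivlMl ?ltr0n //.
case: S S0 {SE} => [s| |] //= _; rewrite ?leey //.
rewrite -EFinD -EFinM !lee_fin ler_pdivrMr //.
by rewrite mulr_natr mulr2n.
Qed.

End converse.

Lemma capacity_region_na_rate (R : realType) (h : user -> R) (P : R) r :
  h 0 = 0 -> capacity_region_na h P r -> r 2 1 = 0.
Proof.
move=> h0 [[r0 _] [c [cna _ err]]]; apply/eqP; rewrite -(negbK (_ == _)).
apply/negP => r21; have {}r21 : 0 < r 2 1 by rewrite lt0r r21 r0.
have half0 : (0 < 2^-1%:E :> \bar R)%E by rewrite lte_fin invr_gt0.
have := err _ (open_ereal_lt' half0).
(* [N.+1] rather than [N]: a positive rate gives two messages only at positive block length. *)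
move=> [N _ /(_ N.+1 (leqnSn _)) /=]; apply/negP; rewrite -leNgt.
by apply: error_na_ge => //; exact: nmsg_gt1.
Qed.

(** * Rare noise events *)

Section finite_valued.
Context d (T : measurableType d).

(** Measurability for the discrete sigma-algebra on [F], stated on fibres as in the field
    [measurable_dec]. *)
Definition measurable_fin (F : finType) (f : T -> F) : Prop :=
  forall a, measurable [set x | f x = a].

Lemma measurable_fin_preimage (F : finType) (f : T -> F) (B : set F) :
  measurable_fin f -> measurable [set x | B (f x)].
Proof.
move=> mf; rewrite (_ : [set _ | _] = \bigcup_(a in B) [set x | f x = a]).
  by apply: fin_bigcup_measurable.
apply/seteqP; split=> x /=; first by move=> Bfx; exists (f x).
by move=> [a Ba ->].
Qed.

Lemma measurable_fin_comp (F G : finType) (f : T -> F) (g : F -> G) :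
  measurable_fin f -> measurable_fin (g \o f).
Proof. by move=> mf a; exact: (measurable_fin_preimage [set x | g x = a]). Qed.

Lemma measurable_fun_fin (F : finType) d' (U : measurableType d') (f : T -> F)
  (g : F -> U) : measurable_fin f -> measurable_fun setT (g \o f).
Proof.
move=> mf _ B mB; rewrite setTI.
exact: (measurable_fin_preimage [set x | B (g x)]).
Qed.

Lemma measurable_fin_bool (f : T -> bool) :
  measurable [set x | f x] -> measurable_fin f.
Proof.
move=> mf [] //; rewrite (_ : [set _ | _] = ~` [set x | f x]).
  exact: measurableC.
by apply/seteqP; split=> x /=; case: (f x).
Qed.

Lemma measurable_fin_ffun (I F : finType) (f : I -> T -> F) :
  (forall i, measurable_fin (f i)) ->
  measurable_fin (fun x => [ffun i => f i x]).
Proof.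
move=> mf a.
rewrite (_ : [set _ | _] = \bigcap_(i in [set: I]) [set x | f i x = a i]).
  by apply: fin_bigcap_measurable => // i _; exact: mf.
apply/seteqP; split=> x /=; first by move=> <- i _; rewrite /= ffunE.
by move=> fa; apply/ffunP => i; rewrite ffunE; exact: fa.
Qed.

End finite_valued.

Lemma measurable_fin_precomp d d' (T : measurableType d) (U : measurableType d')
    (F : finType) (f : U -> F) (g : T -> U) :
  measurable_fin f -> measurable_fun setT g -> measurable_fin (f \o g).
Proof.
move=> mf mg a; rewrite -[X in measurable X]setTI.
exact: (mg measurableT _ (mf a)).
Qed.

(** * Quantisation of equally spaced amplitudes *)

Section quantizer.
Variables (R : realType) (A : R) (Q : nat).
Hypothesis A0 : 0 < A.

(** The open intervals of radius [A / 2] around the amplitudes are disjoint, so at most one symbol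
    qualifies; outputs in none of them fall back to symbol 0. *)
Definition quantize (y : R) : 'I_Q.+1 :=
  odflt ord0 [pick s : 'I_Q.+1 | `|y - A * s%:R| < A / 2].

Lemma quantizeE (s : 'I_Q.+1) (y : R) :
  `|y - A * s%:R| < A / 2 -> quantize y = s.
Proof.
move=> ys; rewrite /quantize; case: pickP => [s' ys'|/(_ s)];
  last by rewrite ys.
apply/val_inj/eqP => /=.
have : `|s'%:R - s%:R : R| < 1.
  rewrite -(ltr_pM2l A0) mulr1 -[X in X * _](gtr0_norm A0) -normrM mulrBr.
  rewrite (_ : A * s'%:R - A * s%:R = (y - A * s%:R) - (y - A * s'%:R));
    last by ring.
  by apply: le_lt_trans (ler_normB _ _) _; rewrite [ltRHS]splitr ltrD.
rewrite !pmulrn -intrB -intr_norm -[1]/(1%:~R) ltr_int; lia.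
Qed.

(** The quantizer depends on [y] only through finitely many tests, each the indicator of a ball. *)
Lemma measurable_quantize : measurable_fin quantize.
Proof.
pose test y : {ffun 'I_Q.+1 -> bool} :=
  [ffun s : 'I_Q.+1 => `|y - A * s%:R| < A / 2].
pose first_true (b : {ffun 'I_Q.+1 -> bool}) := odflt ord0 [pick s | b s].
rewrite (_ : quantize = first_true \o test).
  apply: measurable_fin_comp; apply: measurable_fin_ffun => s.
  apply: measurable_fin_bool.
  rewrite (_ : [set _ | _] = ball (A * s%:R) (A / 2));
    first exact: measurable_ball.
  by apply/seteqP; split => y /=; rewrite /ball /= distrC.
apply/funext => y; rewrite /quantize /=; congr odflt.
by apply: eq_pick => s; rewrite ffunE.
Qed.

End quantizer.

Lemma measure_bigsetU_le d (T : measurableType d) (R : realType)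
    (mu : {content set T -> \bar R}) (I : Type)
    (s : seq I) (P : pred I) (F : I -> set T) :
  (forall i, measurable (F i)) ->
  (mu (\big[setU/set0]_(i <- s | P i) F i) <= \sum_(i <- s | P i) mu (F i))%E.
Proof.
move=> mF; elim: s => [|i s IH]; first by rewrite !big_nil measure0.
rewrite !big_cons; case: ifP => // _.
apply: le_trans (leeD2l _ IH).
by apply: measureU2 => //; exact: bigsetU_measurable.
Qed.

Section rare_event.
Context d (T : measurableType d) (R : realType).

Variables (mu : probability T R) (n k : nat) (B : set T).
Hypothesis mB : measurable B.

Definition visits (x : n.-tuple T) : {set 'I_n} :=
  [set t | `[< B (tnth x t) >]]%SET.

(** Only the times in [S] are constrained: the boxes overlap, but each has a product measure and
    their union is the event of many visits. *)
Let box (S : {set 'I_n}) :=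
  [set x : n.-tuple T | forall t, (if t \in S then B else setT) (tnth x t)].

Let measurable_box S : measurable (box S).
Proof.
rewrite (_ : box S = \bigcap_(t in [set: 'I_n])
    (fun x : n.-tuple T => tnth x t) @^-1` (if t \in S then B else setT)).
  apply: fin_bigcap_measurable => // t _.
  rewrite -[X in measurable X]setTI; apply: measurable_tnth => //.
  by case: ifP.
by apply/seteqP; split=> [x Bx t _|x Bx t]; [exact: Bx|exact: (Bx t)].
Qed.

Let visitsE : [set x | (k < #|visits x|)%N] =
  \big[setU/set0]_(S : {set 'I_n} | (k < #|S|)%N) box S.
Proof.
rewrite -bigcup_seq_cond; apply/seteqP; split=> x /=.
  move=> kx; exists (visits x); first by rewrite /= mem_index_enum.
  by move=> t; case: ifP; rewrite // inE => /asboolP.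
move=> [S /andP[_ kS] Sx]; apply: leq_trans kS _; apply: subset_leq_card.
apply/fintype.subsetP => t tS; rewrite inE; apply/asboolP.
by have := Sx t; rewrite tS.
Qed.

Lemma measurable_many_visits : measurable [set x | (k < #|visits x|)%N].
Proof. by rewrite visitsE; exact: bigsetU_measurable. Qed.

(** Union bound over at most [2 ^ n] sets [S]; by independence each box has measure at most
    [p ^ #|S|], hence at most [p ^ k.+1]. *)
Lemma many_visits_le (p : R) : 0 <= p <= 1 -> (mu B <= p%:E)%E ->
  (iid_law mu n [set x | (k < #|visits x|)%N] <= (2 ^+ n * p ^+ k.+1)%:E)%E.
Proof.
move=> /andP[p0 p1] Bp; rewrite visitsE.
apply: le_trans (measure_bigsetU_le (iid_law mu n) _ _ measurable_box) _.
apply: (@le_trans _ _ (\sum_(S : {set 'I_n} | (k < #|S|)%N) (p ^+ k.+1)%:E)%E).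
  apply: lee_sum => S kS.
  have bE : iid_law mu n (box S) =
      (\prod_(t < n) mu (if t \in S then B else setT))%E.
    apply: (iid_law_box mu (A := fun t => if t \in S then B else setT)) => t.
    by case: ifP.
  apply: (@le_trans _ _ (\prod_(t < n) mu (if t \in S then B else setT))%E).
    by rewrite -bE; exact: lexx.
  apply: (@le_trans _ _ (\prod_(t < n) (if t \in S then p else 1)%:E)%E).
    (* Nonnegativity is carried through the induction since multiplying inequalities requires it. *)
    suff /andP[] : (0 <= \prod_(t < n) mu (if t \in S then B else setT) <=
        \prod_(t < n) (if t \in S then p else 1)%:E)%E by [].
    apply: (big_ind2 (fun x y => 0 <= x <= y)%E).
    - by rewrite lee01 lexx.
    - move=> x1 y1 x2 y2 /andP[? ?] /andP[? ?].
      by rewrite mule_ge0 // lee_pmul.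
    - move=> t _; rewrite measure_ge0 /=.
      by case: ifP => _ //; rewrite probability_setT.
  rewrite prodEFin lee_fin -big_mkcond prodr_const.
  by rewrite ler_wiXn2l.
rewrite sumEFin lee_fin sumr_const -[leLHS]mulr_natl ler_wpM2r ?exprn_ge0 //.
rewrite -natrX ler_nat -[X in (_ <= 2 ^ X)%N]card_ord.
rewrite -[X in (_ <= 2 ^ X)%N]cardsT.
rewrite -card_powerset; apply: subset_leq_card.
by apply/fintype.subsetP => S _; rewrite powersetE finset.subsetT.
Qed.

End rare_event.

Definition large_noise (R : realType) (m : nat) (a : R) : set (m.-tuple R) :=
  [set u | exists i, a <= `|tnth u i|].

Lemma measurable_large_noise (R : realType) (m : nat) (a : R) :
  measurable (@large_noise R m a).
Proof.
rewrite (_ : large_noise a = \bigcup_(i in [set: 'I_m])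
  (fun u : m.-tuple R => tnth u i) @^-1` ~` ball 0 a).
  apply: fin_bigcup_measurable => // i _.
  rewrite -[X in measurable X]setTI; apply: measurable_tnth => //.
  by apply: measurableC; exact: measurable_ball.
apply/seteqP; split=> u /=.
  move=> [i ai]; exists i => //=; rewrite /ball /= sub0r normrN.
  by apply/negP; rewrite -leNgt.
move=> [i _ /=]; rewrite /ball /= sub0r normrN => /negP.
by rewrite -leNgt; exists i.
Qed.

(** The complements increase to the whole space as the threshold grows, so continuity from below
    makes their measure exceed [1 - p]. *)
Lemma large_noise_small (R : realType) (m : nat)
    (mu : probability (m.-tuple R) R) (p : R) :
  0 < p -> exists2 a : R, 0 < a & (mu (large_noise a) <= p%:E)%E.
Proof.
move=> p0.
pose F (k : nat) := ~` large_noise (k%:R : R) : set (m.-tuple R).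
have mF k : measurable (F k).
  by apply: measurableC; exact: measurable_large_noise.
have FT : \bigcup_k F k = setT.
  apply/seteqP; split=> // u _.
  (* The sum dominates every coordinate, so any integer above it is a threshold for [u]. *)
  pose M := \sum_(i < m) `|tnth u i|.
  exists (Num.truncn M).+1 => // -[i]; apply/negP; rewrite -ltNge.
  apply: le_lt_trans (truncnS_gt M).
  by rewrite /M (bigD1 i) //= lerDl sumr_ge0.
have ndF : nondecreasing_seq F.
  move=> k l kl; apply/subsetPset => u Fk [i li]; apply: Fk; exists i.
  by apply: le_trans li; rewrite ler_nat.
have := nondecreasing_cvg_mu (mu := mu) mF _ ndF.
rewrite FT => /(_ measurableT) cvg.
have p1 : ((1 - p)%:E < mu setT)%E.
  by rewrite (_ : mu setT = 1%:E) ?lte_fin; [lra|exact: probability_setT].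
have [N _ /(_ N.+1 (leqnSn _)) /= hN] := cvg _ (open_ereal_gt' p1).
exists N.+1%:R; first by rewrite ltr0n.
have mL := @measurable_large_noise R m N.+1%:R.
move: hN; rewrite /F probability_setC //.
have := fin_num_measure mu _ mL.
case: (mu _) => [x _| |] //; last by rewrite leNye.
change ((1 - p)%:E < (1 - x)%:E -> x%:E <= p%:E)%E.
by rewrite lte_fin lee_fin; lra.
Qed.

(** * The relay code *)

Lemma message_mean_le (R : realType) n r (F : messages n r -> \bar R) (e : R) :
  0 <= e -> (forall w, F w <= e%:E)%E -> (message_mean F <= e%:E)%E.
Proof.
move=> e0 Fe; rewrite /message_mean.
apply: (@le_trans _ _
  (#|messages n r|%:R^-1%:E * \sum_(w : messages n r) e%:E)%E).
  by apply: lee_wpmul2l; [rewrite lee_fin invr_ge0|apply: lee_sum].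
rewrite sumEFin sumr_const -EFinM lee_fin -[e *+ _]mulr_natl mulrA.
case: #|_| => [|m]; first by rewrite invr0 !mul0r.
by rewrite mulVf ?mul1r // pnatr_eq0.
Qed.

Lemma measurable_nth (R : realType) (m k : nat) (x0 : R) :
  measurable_fun setT (fun y : m.-tuple R => nth x0 y k).
Proof.
have [km|mk] := ltnP k m; last first.
  rewrite (_ : (fun _ => _) = cst x0) //; apply/funext => y.
  by rewrite nth_default ?size_tuple.
rewrite (_ : (fun _ => _) = (@tnth _ R)^~ (Ordinal km));
  first exact: measurable_tnth.
by apply/funext => y; rewrite (tnth_nth x0).
Qed.

Lemma nth_received (R : realType) n r h (c : code n r) (w : messages n r)
    (z : n.-tuple (3.-tuple R)) (i : user) (s t : nat) : (s < t)%N ->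
  nth 0 (received h c w z t i) s =
  h (i + 1) * transmitted h c w z s (i + 2) +
  h (i + 2) * transmitted h c w z s (i + 1) + noise z s i.
Proof.
elim: t => // t IH; rewrite ltnS leq_eqVlt => /orP[/eqP ->|st].
  by rewrite /= nth_rcons size_tuple ltnn eqxx.
by rewrite /= nth_rcons size_tuple st IH.
Qed.

Section relay_code.
Context (R : realType) (rho A : R) (Q n d : nat).
Hypothesis A0 : 0 < A.
Variable cb : nat -> {ffun 'I_n -> 'I_Q.+1}.

Definition relay_rate (a b : user) : R :=
  if (a == 2) && (b == 1) then rho else 0.

(** User 0 forwards its latest output, at index [t.-1]; at time 0 it has none and quantises the
    default 0. User 1 sends the codeword of its message to user 2, and user 2 is silent. *)
Definition relay_enc (i : user) (t : nat) (v : forall a, msg n relay_rate a i)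
    (y : t.-tuple R) : R :=
  if i == 0 then A * (quantize A Q (nth 0 y t.-1))%:R
  else if i == 1 then A * (oapp (cb (v 2)) ord0 (insub t))%:R
  else 0.

(** The index [t.+1] undoes the relay delay of one time unit; the last position falls outside [y]
    and reads the default 0. *)
Definition word_estimate (y : n.-tuple R) : {ffun 'I_n -> 'I_Q.+1} :=
  [ffun t : 'I_n => quantize A Q (nth 0 y t.+1)].

(** Bounded-distance decoding: the choice is unique once codewords differ in more than [2 d]
    positions. *)
Definition word_decode M (u : {ffun 'I_n -> 'I_Q.+1}) : option 'I_M :=
  [pick m : 'I_M | (#|diff_set (cb m) u| <= d)%N].

Definition relay_dec (i : user) (v : forall a, msg n relay_rate a i)
    (y : n.-tuple R) (b : user) : msg n relay_rate i b :=
  odflt (Ordinal (nmsg_gt0 n (relay_rate i b)))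
    (word_decode (nmsg n (relay_rate i b)) (word_estimate y)).

Lemma measurable_relay_enc i t v : measurable_fun setT (@relay_enc i t v).
Proof.
rewrite /relay_enc; case: (i == 0) => /=; last first.
  exact: (measurable_cst
    (if i == 1 then A * (oapp (cb (v 2)) ord0 (insub t))%:R else 0)).

apply: (@measurable_fun_fin _ _ _ _ _
  (fun y : t.-tuple R => quantize A Q (nth 0 y t.-1))
  (fun s => A * s%:R)).
apply: (@measurable_fin_precomp _ _ _ _ _ (quantize A Q));
  first exact: measurable_quantize.
exact: measurable_nth.
Qed.

Lemma measurable_relay_dec i v b (m : msg n relay_rate i b) :
  measurable [set y | @relay_dec i v y b = m].
Proof.
have mE : measurable_fin word_estimate; last first.
  exact: (measurable_fin_preimage
    [set u | odflt (Ordinal (nmsg_gt0 n (relay_rate i b)))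
      (word_decode (nmsg n (relay_rate i b)) u) = m] mE).
apply: measurable_fin_ffun => t.
apply: (@measurable_fin_precomp _ _ _ _ _ (quantize A Q));
  first exact: measurable_quantize.
exact: measurable_nth.
Qed.

Definition relay_code : code n relay_rate :=
  Code measurable_relay_enc measurable_relay_dec.

Variable h : user -> R.

(** Every amplitude sent lies between 0 and [A * Q%:R], so the bound holds surely at each time,
    whatever the noise. *)
Lemma relay_code_power : power_constraint h ((A * Q%:R) ^+ 2) relay_code.
Proof.
move=> i; have P0 : 0 <= (A * Q%:R) ^+ 2 by exact: sqr_ge0.
have bound t : (mean_power h relay_code i t <= ((A * Q%:R) ^+ 2)%:E)%E.
  apply: message_mean_le => // w.
  apply: (@le_trans _ _ (\int[noise_law R n]_z (cst ((A * Q%:R) ^+ 2)%:E z))%E).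
    apply: ge0_le_integral => //.
    - by move=> z _; rewrite lee_fin sqr_ge0.
    - apply/measurable_EFinP; apply: measurable_funX.
      exact: measurable_transmitted.
    - move=> z _; rewrite lee_fin /transmitted /= /relay_enc.
      have le (s : 'I_Q.+1) : (A * s%:R) ^+ 2 <= (A * Q%:R) ^+ 2.
        rewrite ler_pXn2r // ?nnegrE ?mulr_ge0 ?(ltW A0) //.
        by rewrite ler_pM2l // ler_nat -ltnS.
      by case: ifP => _ //; case: ifP => _ //; rewrite expr0n.
  rewrite integral_cst //.
  suff : (((A * Q%:R) ^+ 2)%:E * noise_law R n setT <=
      ((A * Q%:R) ^+ 2)%:E)%E by [].
  rewrite (_ : noise_law R n setT = 1%:E) ?mule1 //.
  exact: probability_setT.
apply: (@le_trans _ _ (n%:R^-1%:E * \sum_(t < n) ((A * Q%:R) ^+ 2)%:E)%E).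
  by apply: lee_wpmul2l; [rewrite lee_fin invr_ge0|apply: lee_sum].
rewrite sumEFin sumr_const card_ord -EFinM lee_fin.
rewrite -[(_ ^+ 2) *+ n]mulr_natl mulrA.
case: (n) => [|m]; first by rewrite invr0 !mul0r.
by rewrite mulVf ?mul1r // pnatr_eq0.
Qed.

Hypotheses (h0 : h 0 = 0) (h1 : h 1 = 1) (h2 : h 2 = 1).

Let bad (z : n.-tuple (3.-tuple R)) := visits (large_noise (A / 2)) z.

Lemma noise_small z (t : 'I_n) i : t \notin bad z -> `|noise z t i| < A / 2.
Proof.
rewrite inE => /asboolPn nb; rewrite ltNge; apply/negP => le; apply: nb.
by exists i; move: le; rewrite /noise -tnth_nth.
Qed.

Let transmitted0 w z t : transmitted h relay_code w z t 0 =
  A * (quantize A Q (nth 0 (received h relay_code w z t 0) t.-1))%:R.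
Proof. by []. Qed.

Let transmitted1 w z (t : 'I_n) : transmitted h relay_code w z t 1 =
  A * (cb (w (2, 1)) t)%:R.
Proof. by rewrite /transmitted /= /relay_enc /= valK. Qed.

Let transmitted2 w z t : transmitted h relay_code w z t 2 = 0.
Proof. by []. Qed.

Lemma relay_symbol w z (t s : 'I_n) : s = t.+1 :> nat ->
  t \notin bad z -> s \notin bad z ->
  quantize A Q (nth 0 (received h relay_code w z n 2) s) = cb (w (2, 1)) t.
Proof.
move=> st tb sb.
(* First hop: user 2 is silent, so user 0 hears the symbol of user 1 plus a noise below half the
   spacing. *)
have relayed : quantize A Q (nth 0 (received h relay_code w z s 0) s.-1) =
    cb (w (2, 1)) t.
  apply: quantizeE => //.
  rewrite st /= nth_received //.
  have -> : (0 + 1 : user) = 1 by apply/val_inj.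
  have -> : (0 + 2 : user) = 2 by apply/val_inj.
  rewrite h1 h2 transmitted2 transmitted1 mulr0 add0r mul1r addrAC subrr add0r.
  exact: noise_small.
(* Second hop: [h 0 = 0] removes the direct signal of user 1, leaving the forwarded symbol and small
   noise. *)
apply: quantizeE => //; rewrite nth_received //.
have -> : (2 + 1 : user) = 0 by apply/val_inj.
have -> : (2 + 2 : user) = 1 by apply/val_inj.
rewrite h1 h0 transmitted0 relayed mul0r add0r mul1r addrAC subrr add0r.
exact: noise_small.
Qed.

(* Besides the errors caused by noise at time t (first hop) or t + 1 (second
   hop), the last symbol of the word never reaches user 2. *)
Lemma card_symbol_errors (w : messages n relay_rate) z :
  (#|diff_set (cb (w (2, 1)%R))
       (word_estimate (received h relay_code w z n 2%R))|
   <= (#|bad z|).*2.+1)%N.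
Proof.
set D := diff_set _ _.
(* [ordS] is cyclic and agrees with [t.+1] except at the last time, which the third set contains.
   Being injective, it gives a preimage no larger than [bad z]. *)
have sub : (D \subset bad z :|: (@ordS n) @^-1: bad z :|:
    [set t : 'I_n | t.+1 == n :> nat])%SET.
  apply/fintype.subsetP => t; rewrite inE; apply: contraR.
  rewrite !finset.in_setU !negb_or => /andP[/andP[tb]].
  rewrite !(finset.in_set, finset.inE) /= => sb tn.
  have tn' : (t.+1 < n)%N by rewrite ltn_neqAle tn ltn_ord.
  rewrite ffunE.
  have oE : ordS t = t.+1 :> nat by rewrite /= modn_small.
  by rewrite -oE (relay_symbol _ oE) //; rewrite finset.inE.
apply: leq_trans (subset_leq_card sub) _.
apply: leq_trans (leq_card_setU _ _) _; rewrite -addn1 leq_add //.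
  apply: leq_trans (leq_card_setU _ _) _; rewrite -addnn leq_add2l.
  by rewrite card_preimset //; exact: ordS_inj.
case: (n) => [|m]; first by rewrite (leq_trans (max_card _)) // card_ord.
rewrite -(cards1 (ord_max : 'I_m.+1)); apply: subset_leq_card.
apply/fintype.subsetP => t; rewrite !finset.inE eqSS => /eqP tm.
by apply/eqP/val_inj.
Qed.

Hypothesis cb_far : forall m m', (m < nmsg n rho)%N -> (m' < nmsg n rho)%N ->
  m != m' -> (d.*2 < #|diff_set (cb m) (cb m')|)%N.

(** With fewer noisy times the estimate is within [d] of the word sent, and the triangle inequality
    excludes any other codeword within [d]. *)
Lemma relay_decoding_error w z :
  decoding_error h relay_code w z -> (d <= (#|bad z|).*2)%N.
Proof.
move=> [i [b err]]; rewrite leqNgt; apply/negP => few; apply: err.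
have [/andP[/eqP iE /eqP bE]|ib] := boolP ((i == 2) && (b == 1)); last first.
  (* Every other link has rate 0, hence a single message that cannot be mistaken. *)
  have M1 : nmsg n (relay_rate i b) = 1%N.
    by rewrite /relay_rate (negbTE ib) nmsg0.
  by move: (dec _ _ _ _) (sent_to _ _ _); rewrite /msg M1 => x y; rewrite !ord1.
subst i b; rewrite /= /relay_dec /word_decode.
set u := word_estimate _.
have near : (#|diff_set (cb (w (2, 1)%R)) u| <= d)%N.
  exact: leq_trans (card_symbol_errors w z) few.
case: pickP => [m mu|/(_ (w (2, 1)))]; last by rewrite near.
apply/val_inj/eqP => /=; apply: contraTT mu => mw.
rewrite -ltnNge; have := cb_far (ltn_ord m) (ltn_ord (w (2, 1))) mw.
have := card_diff_set_triangle u (cb m) (cb (w (2, 1))).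
rewrite (diff_set_sym u); lia.
Qed.

End relay_code.

(** An error needs [d] to be at most twice the number of noisy times, hence more than [k] of them;
    [p] bounds the chance that a given time is noisy. *)
Lemma relay_error_probability (R : realType) (rho A : R) (Q n d k : nat)
    (cb : nat -> {ffun 'I_n -> 'I_Q.+1}) (h : user -> R) (p : R) (A0 : 0 < A) :
  h 0 = 0 -> h 1 = 1 -> h 2 = 1 ->
  (forall m m', (m < nmsg n rho)%N -> (m' < nmsg n rho)%N ->
    m != m' -> (d.*2 < #|diff_set (cb m) (cb m')|)%N) ->
  (k.*2 < d)%N -> 0 <= p <= 1 ->
  (iid_law (@standard_normal R) 3 (large_noise (A / 2)) <= p%:E)%E ->
  (error_probability h (relay_code rho A d cb) <= (2 ^+ n * p ^+ k.+1)%:E)%E.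
Proof.
move=> h0 h1 h2 cb_far kd /[dup] p01 /andP[p0 p1] mup.
apply: message_mean_le => [|w].
  by rewrite mulr_ge0 ?exprn_ge0.
have mL := @measurable_large_noise R 3 (A / 2).
apply: le_trans (many_visits_le n k mL p01 mup).
apply: le_measure; rewrite ?inE.
- exact: measurable_decoding_error.
- by apply: measurable_many_visits; exact: mL.
- move=> z /(relay_decoding_error A0 h0 h1 h2 cb_far) /=; lia.
Qed.

(* With q = 2 ^ (2 K + 2) and D <= n / 2, the Gilbert-Varshamov bound
   q ^ (n - D) / 2 ^ n is at least 2 ^ (n K). *)
Lemma codebook_exists (K n : nat) : (8 <= n)%N ->
  exists cb : nat -> {ffun 'I_n -> 'I_(2 ^ (2 * K + 2)).-1.+1},
    forall m m', (m < 2 ^ (n * K))%N -> (m' < 2 ^ (n * K))%N -> m != m' ->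
      (((n %/ 16).*2.+1).*2 < #|diff_set (cb m) (cb m')|)%N.
Proof.
move=> n8; set q := 'I_(2 ^ (2 * K + 2)).-1.+1; set D := _.*2.
have cq : #|q| = (2 ^ (2 * K + 2))%N by rewrite card_ord prednK // expn_gt0.
have [||C [CM Cfar]] := @Gilbert_Varshamov 'I_n q D (2 ^ (n * K)).
- by rewrite cq expn_gt0.
- rewrite cq card_ord -!expnM -!expnD leq_exp2l // /D.
  have := leq_divM n 16; set k := (n %/ 16)%N => kn.
  (* [8 k] and 4 are each at most [n / 2], the latter because [n >= 8]. *)
  have : ((4 * k + 2) * 2 <= n)%N by lia.
  rewrite -!muln2; nia.
exists (fun m => nth [ffun => ord0] (enum C) m) => m m' mM mM' mm'.
have mC x : (x < 2 ^ (n * K))%N -> (x < size (enum C))%N.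
  by move=> xM; rewrite -cardE; exact: leq_trans xM CM.
have sM := mC _ mM; have sM' := mC _ mM'.
apply: Cfar; [by rewrite -mem_enum mem_nth|by rewrite -mem_enum mem_nth|].
by rewrite nth_uniq ?enum_uniq.
Qed.

(** The alphabet size depends only on [rho] and the spacing only on the noise law, so one power [P]
    serves all block lengths. *)
Theorem relay_achievable (R : realType) (rho : R) (h : user -> R) : 0 <= rho ->
  h 0 = 0 -> h 1 = 1 -> h 2 = 1 ->
  exists2 P : R, 0 < P & capacity_region h P (relay_rate rho).
Proof.
move=> rho0 h0 h1 h2.
pose K := (Num.truncn rho).+1.
have rhoK : rho <= K%:R by rewrite ltW // truncnS_gt.
pose Q := (2 ^ (2 * K + 2)).-1.
(* p ^ (n %/ 16 + 1) <= 4 ^- n absorbs the 2 ^ n sets of noisy times *)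
pose p : R := 4 ^- 16.
have p0 : 0 < p by rewrite invr_gt0 exprn_gt0.
have p1 : p <= 1 by rewrite invf_le1 ?exprn_gt0 // exprn_ege1 // ler1n.
have [a a0 mua] := large_noise_small (iid_law (@standard_normal R) 3) p0.
(* Half the spacing must equal the noise threshold [a]. *)
pose A := a *+ 2.
have A0 : 0 < A by rewrite pmulrn_rgt0.
have AE : A / 2 = a by rewrite /A -[a *+ 2]mulr_natr mulfK.
have Q0 : (0 < Q)%N.
  rewrite /Q; have : (2 ^ 1 <= 2 ^ (2 * K + 2))%N by rewrite leq_exp2l //; lia.
  lia.
exists ((A * Q%:R) ^+ 2); first by rewrite exprn_gt0 // mulr_gt0 ?ltr0n.
split.
  split=> [i b|i]; rewrite /relay_rate; first by case: ifP.
  by case: eqP => //= ->.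
have code_n n : exists c : code n (relay_rate rho),
    power_constraint h ((A * Q%:R) ^+ 2) c /\
    ((8 <= n)%N -> (error_probability h c <= ((1 / 2) ^+ n)%:E)%E).
  have [n8|n8] := leqP 8 n; last first.
    (* Below length 8 only the power constraint matters, so a constant codebook serves. *)
    exists (@relay_code R rho A Q n 0 (fun=> [ffun => ord0])).
    by split => [|]; [exact: relay_code_power|].
  have [cb cb_far] := codebook_exists K n8.
  exists (relay_code rho A (n %/ 16).*2.+1 cb); split=> [|_].
    exact: relay_code_power.
  apply: le_trans (relay_error_probability (k := n %/ 16) (p := p)
    A0 h0 h1 h2 _ _ _ _) _.
  - move=> m m' mM mM'; apply: cb_far; exact: leq_trans (nmsg_le _ rhoK).
  - exact: ltnSn.
  - by rewrite (ltW p0) p1.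
  - by rewrite AE.
  rewrite lee_fin /p -exprVn -exprM -[1 / 2](_ : 2 * 4^-1 = _); last by field.
  rewrite exprMn ler_pM2l ?exprn_gt0 //.
  rewrite ler_wiXn2l ?invr_ge0 ?invf_le1 ?ler1n //.
  by rewrite mulnC ltnW // ltn_ceil.
pose c n := projT1 (cid (code_n n)); have cP n := projT2 (cid (code_n n)).
exists c; split=> // [n|]; first by have [] := cP n.
apply: (@squeeze_cvge _ _ _ _ (cst 0%E) _ (fun n => ((1 / 2) ^+ n)%:E)).
- exists 8%N => // n /= n8; have [_ ->] := cP n; rewrite // andbT.
  rewrite mule_ge0 ?lee_fin ?invr_ge0 //.
  by apply: sume_ge0 => w _; exact: measure_ge0.
- exact: cvg_cst.
- apply: cvg_EFin; first by near=> n.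
  apply: cvg_expr; rewrite ger0_norm; lra.
Unshelve. all: by end_near.
Qed.

Theorem mainTheorem6 (R : realType) :
  ~ exists c : R, 0 <= c /\
    forall (h : user -> R) (P : R), 0 < P ->
      SNR h P 0 <= SNR h P 1 -> SNR h P 1 <= SNR h P 2 ->
      forall r : user -> user -> R, capacity_region h P r ->
        capacity_region_na h P (fun a b => Num.max 0 (r a b - c)).
Proof.
move=> [c [c0 gap]].
(* The link between users 1 and 2 is cut and the two links of user 0 have gain 1, which respects the
   SNR order [0 <= P <= P]. *)
pose h (i : user) : R := if i == 0 then 0 else 1.
(* Rate [c + 1] leaves rate 1 after the gap [c] is subtracted, against the rate 0 forced by the
   converse. *)
have [|//|//|//|P P0 relay] := @relay_achievable R (c + 1) h; first by lra.
have := capacity_region_na_rate (erefl : h 0 = 0) (gap h P P0 _ _ _ relay).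
rewrite /SNR /h /= expr0n mul0r expr1n mul1r => /(_ (ltW P0) (lexx _)).
rewrite /relay_rate /= addrAC subrr add0r maxEle ler01 => /eqP.
by rewrite oner_eq0.
Qed.
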